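(* Let $n,s\ge1$ and let $\mathbf{A}\in\mathbb{C}^{n\times n}$ be annihilated by the monic complex polynomial $\mathrm{a}(x)=\sum_{k=0}^{d}a_kx^k\in\mathbb{C}[x]$ of degree $d>0$, i.e. $a_d=1$ and $\mathrm{a}(\mathbf{A})=\mathbf{0}$. Let $\mathbf{B}\in\mathbb{C}^{n\times s}$, $\mathbf{C}\in\mathbb{C}^{s\times n}$, $\mathbf{D}\in\mathbb{C}^{s\times s}$, $\mathbf{M}=\begin{pmatrix}\mathbf{A}&\mathbf{B}\\\mathbf{C}&\mathbf{D}\end{pmatrix}$, and let $$\mathcal{S}(\lambda)=\mathrm{a}(\lambda)(\lambda\mathbf{I}_s-\mathbf{D})-\mathbf{C}\,\mathrm{p}(\lambda\mathbf{I}_n,\mathbf{A};\mathrm{a})\,\mathbf{B}\in(\mathbb{C}[\lambda])^{s\times s}.$$ Then $\mathcal{S}(\lambda)$ has a linearization as a standard eigenproblem, and the spectra of $\mathbf{A}$ and $\mathbf{M}$ are related through $$\sigma(\mathbf{M})=\sigma(\mathbf{A})+\varrho\left(\det(\mathcal{S}(\lambda))\right)-\varrho^s\left(\mathrm{a}(\lambda)\right).$$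
   Context: $\mathrm{p}(\lambda\mathbf{I}_n,\mathbf{A};\mathrm{a})=\sum_{k=1}^{d}a_k\sum_{i=1}^{k}\lambda^{i-1}\mathbf{A}^{k-i}\in(\mathbb{C}[\lambda])^{n\times n}$. For a nonzero polynomial $g(\lambda)$, $\varrho(g)$ is the multiset of its complex roots (counted with multiplicity); $\varrho^s(g)$ is the multiset obtained by multiplying the multiplicity of each distinct element of $\varrho(g)$ by $s$. The spectrum of a square complex matrix $\mathbf{X}$ is the multiset $\sigma(\mathbf{X})=\varrho(\det(\lambda\mathbf{I}-\mathbf{X}))$. Sums and differences of multisets are taken multiplicity-wise. ''A matrix polynomial $\mathcal{S}(\lambda)=\sum_{k=0}^{e}\mathbf{S}_k\lambda^k$, $\mathbf{S}_k\in\mathbb{C}^{s\times s}$, of degree $e$ has a linearization as a standard eigenproblem'' means: there is a matrix $\mathbf{Z}\in\mathbb{C}^{es\times es}$ (for instance a block companion matrix) such that the ordinary eigenvalue problem of $\mathbf{Z}$ is equivalent to the polynomial eigenvalue problem $\mathcal{S}(\lambda)\mathbf{v}=\mathbf{0}$, i.e. there are $es\times es$ matrix polynomials $\mathcal{E}(\lambda),\mathcal{F}(\lambda)$ with constant nonzero determinants such that $\mathcal{E}(\lambda)(\lambda\mathbf{I}-\mathbf{Z})\mathcal{F}(\lambda)=\operatorname{diag}(\mathcal{S}(\lambda),\mathbf{I}_{(e-1)s})$. Here $e=d+1$. *)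

(* Defs.v *)
From HB Require Import structures.
From mathcomp Require Import all_boot all_order all_algebra.
From mathcomp Require Import finmap multiset.
From mathcomp Require Import complex reals.

Set Implicit Arguments.
Unset Strict Implicit.
Unset Printing Implicit Defensive.

Import Order.TTheory GRing.Theory Num.Theory.

Local Open Scope ring_scope.
Local Open Scope mset_scope.

(* Meaningful for g != 0 only; see root_msetE for the multiplicities. *)
Definition root_mset (F : closedFieldType) (g : {poly F}) : {mset F} :=
  seq_mset (sval (closed_field_poly_normal g)).

Lemma root_msetE (F : closedFieldType) (g : {poly F}) (x : F) :
  g != 0 -> root_mset g x = mup x g.
Proof.
move=> g0; rewrite /root_mset mset_seqE.
case: (closed_field_poly_normal g) => r /= gE.
rewrite gE -mul_polyC mupMr ?mu_prod_XsubC //.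
by rewrite rootE hornerC lead_coef_eq0.
Qed.

Definition mset_scale (K : choiceType) (s : nat) (A : {mset K}) : {mset K} :=
  [fsfun x in finsupp A => (s * A x)%N].

Lemma mset_scaleE (K : choiceType) (s : nat) (A : {mset K}) (x : K) :
  mset_scale s A x = (s * A x)%N.
Proof. by rewrite fsfunE; case: finsuppP => // _; rewrite muln0. Qed.

Definition spectrum (F : closedFieldType) (n : nat) (X : 'M[F]_n) : {mset F} :=
  root_mset (char_poly X).

Definition pdiff_mx (F : closedFieldType) (n : nat) (A : 'M[F]_n)
    (a : {poly F}) : 'M[{poly F}]_n :=
  \sum_(1 <= k < size a) (a`_k)%:P *:
    \sum_(1 <= i < k.+1) 'X^(i - 1) *: map_mx polyC (A ^+ (k - i)).

Definition schur_mxpoly (F : closedFieldType) (n s : nat) (a : {poly F})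
    (A : 'M[F]_n) (B : 'M[F]_(n, s)) (C : 'M[F]_(s, n)) (D : 'M[F]_s) :
    'M[{poly F}]_s :=
  a *: ('X%:M - map_mx polyC D)
    - map_mx polyC C *m pdiff_mx A a *m map_mx polyC B.

Definition mxpoly_degree (F : closedFieldType) (s : nat)
    (S : 'M[{poly F}]_s) (e : nat) : Prop :=
  (\max_(i < s) \max_(j < s) size (S i j))%N = e.+1.

Definition unimodular (F : closedFieldType) (m : nat)
    (E : 'M[{poly F}]_m) : Prop :=
  exists2 c : F, c != 0 & \det E = c%:P.

(* The order e * s is written s + e.-1 * s (the same number, as 0 < e), so that
   diag(S, I) is a block matrix of that order without any cast. *)
Definition has_standard_linearization (F : closedFieldType) (s e : nat)
    (S : 'M[{poly F}]_s) : Prop :=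
  [/\ (0 < e)%N,
      mxpoly_degree S e
    & exists (Z : 'M[F]_(s + e.-1 * s)) (E G : 'M[{poly F}]_(s + e.-1 * s)),
        [/\ unimodular E,
            unimodular G
          & E *m ('X%:M - map_mx polyC Z) *m G = block_mx S 0 0 1%:M]].

(* Main.v *)
(* Telescoping gives (X - A) p = a(X) - a(A) = a(X), where p = pdiff_mx A a.
   Block elimination on the characteristic matrix of M then yields
   char_poly M * a ^ s = char_poly A * det S, and the identity of multisets is
   read off the multiplicities of the roots. Since a is monic of degree d, S is
   monic of degree d + 1. Writing a monic matrix polynomial as X T + S0, the
   matrix diag(S, I) is equivalent to [[X, S0], [-I, T]], so an induction on the
   degree builds a block companion linearization. *)
Require Import Defs.
From mathcomp Require Import all_boot all_order all_algebra.
From mathcomp Require Import finmap multiset complex reals.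
Set Implicit Arguments.
Unset Strict Implicit.
Unset Printing Implicit Defensive.

Import GRing.Theory.

Local Open Scope ring_scope.
Local Open Scope mset_scope.

(** * Companion linearization of monic matrix polynomials *)

Lemma unimodular_unitmx (F : closedFieldType) (m : nat) (E : 'M[{poly F}]_m) :
  E \in unitmx -> unimodular E.
Proof.
rewrite unitmxE poly_unitE unitfE => /andP[/eqP/eq_leq/size1_polyC detE c0].
by exists (\det E)`_0.
Qed.

(** Bounding the difference with [X^e I] also covers [e = 0], where it forces [S = I]: this is what
    the base case of the induction meets. *)
Definition monic_mxpoly (F : closedFieldType) (s e : nat)
    (S : 'M[{poly F}]_s) : Prop :=
  forall i j, (size (S i j - 'X^e *+ (i == j))%R <= e)%N.

Lemma monic_mxpoly_degree (F : closedFieldType) (s e : nat)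
    (S : 'M[{poly F}]_s) :
  (0 < s)%N -> monic_mxpoly e S -> mxpoly_degree S e.
Proof.
move=> s0 mS; apply/eqP; rewrite eqn_leq; apply/andP; split.
  apply/bigmax_leqP => i _; apply/bigmax_leqP => j _.
  rewrite -(subrK ('X^e *+ (i == j)) (S i j)).
  apply: leq_trans (size_polyD _ _) _; rewrite geq_max (leq_trans (mS i j)) //=.
  by case: eqP => _; rewrite ?mulr0n ?size_poly0 // mulr1n size_polyXn.
(* A diagonal entry attains the maximal size; one exists because [0 < s]. *)
pose i := Ordinal s0.
apply: leq_trans (leq_bigmax i); apply: leq_trans (leq_bigmax i).
have := mS i i; rewrite eqxx mulr1n => Sii.
by rewrite -(subrK 'X^e (S i i)) addrC size_polyDl size_polyXn.
Qed.

Lemma monic_mxpoly_shift (F : closedFieldType) (s e : nat)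
    (S : 'M[{poly F}]_s) :
  monic_mxpoly e.+1 S ->
  exists2 T, monic_mxpoly e T &
  exists S0 : 'M[F]_s, S = 'X *: T + map_mx polyC S0.
Proof.
move=> mS; exists (map_mx (drop_poly 1) S); last first.
  exists (map_mx (fun p : {poly F} => p`_0) S); apply/matrixP=> i j.
  rewrite !mxE -[LHS](poly_take_drop 1) addrC mulrC expr1; congr (_ + _).
  by rewrite /take_poly poly_def big_ord1 expr0 alg_polyC.
move=> i j; rewrite mxE.
have -> : drop_poly 1 (S i j) - 'X^e *+ (i == j)
        = drop_poly 1 (S i j - 'X^(e.+1) *+ (i == j)).
  by apply/polyP=> k; rewrite coef_drop_poly !coefB !coefMn coef_drop_poly !coefXn addn1.
by rewrite size_drop_poly leq_subLR add1n; exact: mS.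
Qed.

(* The constancy of the first block column of E and of the first block row of G
   is what lets a further companion block be prepended. *)
Lemma monic_companion (F : closedFieldType) (s k : nat)
    (S : 'M[{poly F}]_s) :
  monic_mxpoly k.+1 S ->
  exists (Z : 'M[F]_(s + k * s)) (E G : 'M[{poly F}]_(s + k * s))
    (b : 'M[F]_(s + k * s, s)) (g : 'M[F]_(s, s + k * s)),
  [/\ E \in unitmx, G \in unitmx, lsubmx E = map_mx polyC b,
      usubmx G = map_mx polyC g &
      'X%:M - map_mx polyC Z = E *m block_mx S 0 0 1%:M *m G].
Proof.
elim: k S => [|k IH] S mS.
  have [T mT [S0 ->]] := monic_mxpoly_shift mS.
  have -> : T = 1%:M.
    apply/matrixP=> i j; have := mT i j; rewrite leqn0 size_poly_eq0 subr_eq0.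
    by rewrite !mxE expr0 => /eqP.
  (* Here [S = X + S0], so [Z] is [- S0], bordered by empty blocks. *)
  exists (block_mx (- S0) 0 0 0), 1%:M, 1%:M, (col_mx 1%:M 0), (row_mx 1%:M 0).
  rewrite !unitmx1 mul1mx mulmx1; split=> //.
  - by rewrite (@scalar_mx_block _ s) block_mxEh row_mxKl map_col_mx map_mx1 map_mx0.
  - by rewrite (@scalar_mx_block _ s) block_mxEv col_mxKu map_row_mx map_mx1 map_mx0.
  rewrite (@scalar_mx_block _ s) map_block_mx opp_block_mx add_block_mx.
  rewrite !map_mx0 !subr0 map_mxN opprK scalemx1; congr block_mx.
  by apply/matrixP=> [[]].
have [T mT [S0 ->]] := monic_mxpoly_shift mS.
have [Z [E [G [b [g [uE uG Eb Gg ZE]]]]]] := IH _ mT.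
pose P := map_mx (@polyC F).
(* [U] and [V] are chosen so that [U diag(S, I) V] is [[[X, S0], [-I, T]]] padded by an identity
   block. [U] is its own inverse and [W] is that of [V]. *)
pose U : 'M[{poly F}]_(s + (s + k * s)) :=
  block_mx 1%:M (row_mx 'X%:M 0) 0 (block_mx (- 1%:M) 0 0 1%:M).
pose V : 'M[{poly F}]_(s + (s + k * s)) :=
  block_mx 0 (row_mx 1%:M 0) (col_mx 1%:M 0) (block_mx (- T) 0 0 1%:M).
pose W : 'M[{poly F}]_(s + (s + k * s)) :=
  block_mx T (row_mx 1%:M 0) (col_mx 1%:M 0) (block_mx 0 0 0 1%:M).
have UU : U *m U = 1%:M.
  rewrite /U mulmx_block mul1mx !mulmx0 !mul0mx mul_row_block mulmx_block.
  rewrite !mulmx0 !mul0mx !mulmx1 !mul1mx !addr0 !add0r !mulmxN !mulmx1 opprK.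
  by rewrite add_row_mx subrr addr0 row_mx0 -!scalar_mx_block.
have VW : V *m W = 1%:M.
  rewrite /V /W mulmx_block mul_row_block mul_row_col mul_col_row mul_block_col mulmx_block.
  rewrite mul_col_mx !(mulmx0, mul0mx, mulmx1, mul1mx, addr0, add0r).
  rewrite add_col_mx subrr addr0 col_mx0 row_mx0 add_block_mx !(addr0, add0r).
  by rewrite -!scalar_mx_block.
(* Multiplying by [diag(I, E)] on the left and [diag(I, G)] on the right turns [diag(T, I)] into
   [X - Z], the block [-I] into [- b] and [S0] into [S0 g]. As [b] and [g] are constant, the new
   matrix has entries in [F]. *)
exists (block_mx 0 (- (S0 *m g)) b Z), (block_mx 1%:M 0 0 E *m U),
  (V *m block_mx 1%:M 0 0 G), (col_mx 1%:M 0), (row_mx 0 g).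
split.
- rewrite unitmx_mul (proj1 (mulmx1_unit UU)) andbT.
  by rewrite unitmxE det_ublock det1 mul1r -unitmxE.
- rewrite unitmx_mul (proj1 (mulmx1_unit VW)) /=.
  by rewrite unitmxE det_ublock det1 mul1r -unitmxE.
- rewrite /U mulmx_block block_mxEh row_mxKl.
  rewrite !(mulmx0, mul0mx, mulmx1, addr0).
  by rewrite map_col_mx map_mx1 map_mx0.
- rewrite /V mulmx_block block_mxEv col_mxKu.
  rewrite !(mulmx0, mul0mx, addr0, add0r).
  rewrite -{1}[G]vsubmxK mul_row_col mul1mx mul0mx addr0 Gg.
  by rewrite map_row_mx map_mx0.
have -> : 'X%:M - map_mx polyC (block_mx 0 (- (S0 *m g)) b Z) =
  block_mx 'X%:M (P _ _ S0 *m P _ _ g) (- P _ _ b) ('X%:M - P _ _ Z).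
  rewrite (@scalar_mx_block _ s) map_block_mx opp_block_mx add_block_mx.
  by rewrite map_mx0 subr0 map_mxN opprK !add0r map_mxM.
rewrite -!mulmxA (mulmxA U) (mulmxA (U *m _)).
have -> : U *m block_mx ('X *: T + map_mx polyC S0) 0 0 1%:M *m V =
  block_mx 'X%:M (row_mx (P _ _ S0) 0) (col_mx (- 1%:M) 0) (block_mx T 0 0 1%:M).
  rewrite /U /V -mulmxA !mulmx_block !(mulmx0, mul0mx, mul1mx, addr0, add0r).
  rewrite mul_row_col mul_row_block mul_block_col mulmx_block mul_mx_row.
  rewrite !(mulmx0, mul0mx, mulmx1, mul1mx, addr0, add0r) add_row_mx.
  by rewrite mulmxN !mulNmx !mul1mx opprK mul_scalar_mx addr0 addrC addrA addNr add0r.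
rewrite !mulmx_block !(mulmx0, mul0mx, mulmx1, mul1mx, addr0, add0r).
congr block_mx; last by rewrite mulmxA.
  by rewrite -{1}[G]vsubmxK mul_row_col mul0mx addr0 Gg.
by rewrite -{1}[E]hsubmxK mul_row_col mulmx0 addr0 mulmxN mulmx1 Eb.
Qed.

Lemma monic_mxpoly_linearization (F : closedFieldType) (s k : nat)
    (S : 'M[{poly F}]_s) :
  (0 < s)%N -> monic_mxpoly k.+1 S -> has_standard_linearization k.+1 S.
Proof.
move=> s0 mS; split=> //; first exact: monic_mxpoly_degree.
have [Z [E [G [_ [_ [uE uG _ _ ZE]]]]]] := monic_companion mS.
exists Z, (invmx E), (invmx G).
split; try by apply: unimodular_unitmx; rewrite unitmx_inv.
by rewrite ZE -!mulmxA mulKmx // mulmxV // mulmx1.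
Qed.

(** * The divided difference and the leading term of S *)

Lemma pdiff_mxK (F : closedFieldType) (n : nat) (A : 'M[F]_n.+1)
    (a : {poly F}) :
  ('X%:M - map_mx polyC A) *m pdiff_mx A a =
  a%:M - map_mx polyC (horner_mx A a).
Proof.
set A' := map_mx polyC A.
have comA : GRing.comm ('X%:M : 'M_n.+1) A' by exact: comm_scalar_mx.
have powA k : map_mx polyC (A ^+ k) = A' ^+ k by rewrite /A' rmorphXn.
have powX k : ('X%:M : 'M_n.+1) ^+ k = ('X^k)%:M by rewrite rmorphXn.
have -> : a%:M - map_mx polyC (horner_mx A a) =
    \sum_(0 <= k < size a) (a`_k)%:P *: (('X%:M : 'M_n.+1) ^+ k - A' ^+ k).
  rewrite big_mkord -{1 2}[a]coefK poly_def !raddf_sum /= -big_split.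
  apply: eq_bigr => k _; rewrite linearZ /= rmorphXn /= horner_mx_X.
  by rewrite map_mxZ powA scalerBr powX -mul_polyC -scale_scalar_mx.
rewrite /pdiff_mx mulmx_sumr.
case: (size a) => [|m]; first by rewrite !big_geq.
(* The constant coefficient cancels, so both sums start at [k = 1]. *)
rewrite [RHS]big_nat_recl // !expr0 subrr scaler0 add0r big_add1.
apply: eq_bigr => k _; rewrite -scalemxAr; congr (_ *: _).
rewrite subrXX_comm // -mulmxE; congr (_ *m _).
(* The inner sum of [pdiff_mx] has ascending powers of [X], the factorization of [x^k - y^k]
   descending ones. *)
rewrite big_add1 /= big_mkord (reindex_inj rev_ord_inj) /=.
apply: eq_bigr => i _; rewrite subn1 /= powA powX.
rewrite mul_scalar_mx.
by rewrite !subSS subKn // -ltnS.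
Qed.

(** The highest power of [X] is [X^(k-1)] with [k] at most the degree of [a]; hence the term in [B]
    and [C] cannot reach the leading term of S. *)
Lemma size_pdiff_mx (F : closedFieldType) (n : nat) (A : 'M[F]_n)
    (a : {poly F}) i j :
  (size (pdiff_mx A a i j) <= (size a).-1)%N.
Proof.
rewrite /pdiff_mx summxE big_nat; apply: leq_trans (size_sum _ _ _) _.
apply/bigmax_leqP_seq => k _ /andP[k0 ka]; rewrite mxE mul_polyC.
apply: leq_trans (size_scale_leq _ _) _; rewrite summxE big_nat.
apply: leq_trans (size_sum _ _ _) _; apply/bigmax_leqP_seq => l _ /andP[l0 lk].
rewrite !mxE mulrC mul_polyC; apply: leq_trans (size_scale_leq _ _) _.
by rewrite size_polyXn subn1 prednK // -ltnS (leq_trans lk) // (ltn_predK ka).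
Qed.

Lemma schur_mxpoly_monic (F : closedFieldType) (n s d : nat) (a : {poly F})
    (A : 'M[F]_n) (B : 'M[F]_(n, s)) (C : 'M[F]_(s, n)) (D : 'M[F]_s) :
  size a = d.+1 -> a \is monic ->
  monic_mxpoly d.+1 (schur_mxpoly a A B C D).
Proof.
move=> a_deg a_monic i j; rewrite /schur_mxpoly.
set Q := _ *m _ *m _.
have Qij : (size (Q i j) <= d.+1)%N.
  rewrite mxE; apply: leq_trans (size_sum _ _ _) _.
  apply/bigmax_leqP => k _; rewrite [X in _ * X]mxE mulrC mul_polyC.
  apply: leq_trans (size_scale_leq _ _) _; rewrite mxE.
  apply: leq_trans (size_sum _ _ _) _.
  apply/bigmax_leqP => l _; rewrite mxE mul_polyC.
  apply: leq_trans (size_scale_leq _ _) _.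
  by apply: leq_trans (size_pdiff_mx _ _ _ _) _; rewrite a_deg.
(* The leading terms cancel because [a] is monic of degree [d]. *)
have aX : (size (a * 'X - 'X^(d.+1))%R <= d.+1)%N.
  apply/leq_sizeP => k; rewrite leq_eqVlt => /orP[/eqP<-|dk].
    rewrite coefB coefMX coefXn eqxx /=.
    by move/monicP: a_monic; rewrite /lead_coef a_deg => ->; rewrite subrr.
  case: k dk => // k dk; rewrite coefB coefMX coefXn (gtn_eqF dk) subr0 /=.
  by rewrite nth_default // a_deg.
have -> : (a *: ('X%:M - map_mx polyC D) - Q) i j - 'X^(d.+1) *+ (i == j) =
   ((a * 'X - 'X^(d.+1)) *+ (i == j)) - (D i j *: a + Q i j).
  rewrite !mxE mulrBr mulrnAr mulrnBl -mul_polyC [_%:P * a]mulrC opprD !addrA.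
  by rewrite [LHS]addrAC -!addrA; congr (_ + _); rewrite addrCA.
apply: leq_trans (size_polyD _ _) _; rewrite size_polyN geq_max; apply/andP; split.
  by case: eqP => _; rewrite ?mulr1n // mulr0n size_poly0.
apply: leq_trans (size_polyD _ _) _; rewrite geq_max Qij andbT.
by apply: leq_trans (size_scale_leq _ _) _; rewrite a_deg.
Qed.

(* Block elimination: right multiplication of the characteristic matrix of M by
   [[1, pdiff * B], [0, a]] clears the block -B and leaves S in the corner. *)
Lemma det_schur_mxpoly (F : closedFieldType) (n s : nat) (a : {poly F})
    (A : 'M[F]_n.+1) (B : 'M[F]_(n.+1, s)) (C : 'M[F]_(s, n.+1))
    (D : 'M[F]_s) :
  horner_mx A a = 0 ->
  char_poly (block_mx A B C D) * a ^+ s =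
  char_poly A * \det (schur_mxpoly a A B C D).
Proof.
move=> aA0; rewrite /char_poly -det_scalar.
rewrite -[\det a%:M]mul1r -(det1 _ n.+1).
rewrite -(det_ublock _ (pdiff_mx A a *m map_mx polyC B)) -det_mulmx.
rewrite -(det_lblock _ (- map_mx polyC C)); congr (\det _).
rewrite /char_poly_mx map_block_mx (@scalar_mx_block _ n.+1).
rewrite opp_block_mx add_block_mx !sub0r mulmx_block.
rewrite !mulmx1 !mulmx0 !addr0 mulmxA pdiff_mxK aA0 map_mx0 subr0.
rewrite mul_scalar_mx mul_mx_scalar scalerN subrr mul_mx_scalar.
by rewrite mulNmx mulmxA [X in block_mx _ _ _ X]addrC.
Qed.

(** * From the determinant identity to multisets of roots *)

Lemma root_msetM (F : closedFieldType) (p q : {poly F}) :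
  p != 0 -> q != 0 -> root_mset (p * q) = root_mset p `+` root_mset q.
Proof.
move=> p0 q0; apply/msetP => x.
by rewrite msetE2 !root_msetE ?mulf_neq0 // mupM.
Qed.

Lemma root_msetX (F : closedFieldType) (p : {poly F}) (s : nat) :
  p != 0 -> root_mset (p ^+ s) = mset_scale s (root_mset p).
Proof.
move=> p0; apply/msetP => x; elim: s => [|s IH].
  rewrite mset_scaleE root_msetE ?oner_neq0 //.
  by rewrite mupNroot // rootE hornerC oner_eq0.
by rewrite exprS root_msetM ?expf_neq0 // msetE2 IH !mset_scaleE mulSn.
Qed.

Unset Implicit Arguments.

Theorem corollary4 (R : realType) (n s d : nat) (a : {poly R[i]})
    (A : 'M[R[i]]_n.+1) (B : 'M[R[i]]_(n.+1, s)) (C : 'M[R[i]]_(s, n.+1))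
    (D : 'M[R[i]]_s)
    (hs : (0 < s)%N) (hd : (0 < d)%N)
    (ha_deg : size a = d.+1) (ha_monic : a \is monic)
    (haA : horner_mx A a = 0) :
  let M := block_mx A B C D in
  let S := schur_mxpoly a A B C D in
  [/\ has_standard_linearization d.+1 S,
      \det S != 0,
      mset_scale s (root_mset a) `<=` spectrum A `+` root_mset (\det S)
    & spectrum M =
        (spectrum A `+` root_mset (\det S)) `\` mset_scale s (root_mset a)].
Proof.
move=> M S.
have detE : char_poly M * a ^+ s = char_poly A * \det S.
  exact: det_schur_mxpoly.
have as0 : a ^+ s != 0 by rewrite expf_neq0 // monic_neq0.
have chM0 : char_poly M != 0 by rewrite monic_neq0 // char_poly_monic.
have chA0 : char_poly A != 0 by rewrite monic_neq0 // char_poly_monic.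
have S0 : \det S != 0.
  apply: contraNneq (mulf_neq0 chM0 as0) => S0.
  by rewrite detE S0 mulr0.
(* Multiset difference truncates at zero, so the additive form is proved first; the inclusion and
   the difference both follow from it. *)
have sumE : spectrum M `+` mset_scale s (root_mset a) =
            spectrum A `+` root_mset (\det S).
  by rewrite -root_msetX ?monic_neq0 // -!root_msetM // detE.
split=> //.
- exact/monic_mxpoly_linearization/schur_mxpoly_monic.
- by rewrite -sumE; apply/msubsetP => x; rewrite msetE2 leq_addl.
by rewrite -sumE; apply/msetP => x; rewrite !msetE2 addnK.
Qed.
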